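(* A non-wasteful mechanism for online fair division is shared envy-free ex ante if and only if it is ex ante equivalent to the Like mechanism.
   Context: Setting. An online fair division instance consists of a set of agents $N=\{1,\ldots,n\}$, an ordered set of indivisible items $O=\{o_1,\ldots,o_m\}$, and sincere utilities $u_{ij}\in\mathbb{R}_{\ge 0}$ of each agent $i\in N$ for each item $o_j$. It is supposed that at least one agent has positive utility for every item (otherwise the item can simply be discarded). Item $o_j$ arrives at round $j$, and each agent $i$ places a bid $v_{ij}\in\mathbb{R}_{\ge 0}$ for it; agents are supposed to bid sincerely, i.e. $v_{ij}=u_{ij}$. An (online) mechanism allocates $o_j$ immediately and irrevocably (possibly with randomization), with the allocation of $o_1,\ldots,o_{j-1}$ fixed and with no information about $o_{j+1},\ldots,o_m$; thus its behaviour on $o_1,\ldots,o_j$ depends only on the bids for $o_1,\ldots,o_j$. An allocation $\pi_j$ of $o_1,\ldots,o_j$ gives a bundle $\pi_{ji}$ to each agent $i$, with the bundles pairwise disjoint and with union $\{o_1,\ldots,o_j\}$; $\Pi_j$ is the set of all such allocations, and a mechanism induces a probability distribution over $\Pi_j$. A mechanism is non-wasteful if it shares the probability of 1 for each $o_j$ only among agents that bid positively for it if there is at least one such agent and, otherwise, discards $o_j$. Write $p_{ih}(\Pi_j)$ for the probability that agent $i$ receives item $o_h$ in this distribution, $\overline{u}_{ik}(\Pi_j)=\sum_{h=1}^{j}p_{kh}(\Pi_j)\,u_{ih}$ for the expected utility of agent $i$ for the expected allocation of agent $k$, and $$\overline{u}^{\mathrm{SEFA}}_{ik}(\Pi_j)=\sum_{\substack{1\le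 h\le j\\ u_{kh}>0}}p_{ih}(\Pi_j)\,u_{ih}$$ for the expected utility of agent $i$ over the items among $o_1,\ldots,o_j$ that both $i$ and $k$ like (value positively). Shared envy-free ex ante: for each instance of $m\in\mathbb{N}$ items, $\overline{u}^{\mathrm{SEFA}}_{ik}(\Pi_m)\ge\overline{u}_{ik}(\Pi_m)$ for all $i,k\in N$. Two mechanisms are ex ante equivalent if, for each instance of $m\in\mathbb{N}$ items, each agent $i\in N$ and each item $o_j\in O$, the probabilities of $i$ for $o_j$ under both mechanisms are equal. Like mechanism: each arriving item $o_j$ is given to an agent chosen uniformly at random among the agents $i$ with $v_{ij}>0$ (independently of the earlier allocation). *)

(* Defs.v *)
From mathcomp Require Import all_boot all_order all_algebra.
From mathcomp Require Import reals.

Set Implicit Arguments.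
Unset Strict Implicit.
Unset Printing Implicit Defensive.

Import Order.TTheory GRing.Theory Num.Theory.
Local Open Scope ring_scope.

(* Utilities and bids of n agents for m items form a matrix in 'M[R]_(n, m):
   the entry (i, j) belongs to agent i and item j, and items arrive in the
   order of the columns. *)
Definition instance (R : realType) (n m : nat) (u : 'M[R]_(n, m)) : Prop :=
  (forall i j, 0 <= u i j) /\ (forall j, exists i, 0 < u i j).

(* An allocation of m items; the bundle of agent i is the preimage of Some i,
   and None marks a discarded item.  Bundles are thus pairwise disjoint, and
   they cover all the items exactly when no item is discarded. *)
Definition allocation (n m : nat) : finType := {ffun 'I_m -> option 'I_n}.

Definition bid_prefix (R : realType) (n m : nat) (v : 'M[R]_(n, m))
    (j : 'I_m) : 'M[R]_(n, j.+1) :=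
  colsub (widen_ord (ltn_ord j)) v.

Definition alloc_prefix (n m : nat) (a : allocation n m)
    (j : 'I_m) : allocation n j :=
  [ffun h : 'I_j => a (widen_ord (ltnW (ltn_ord j)) h)].

(* With j items already allocated, [rule j v a] is the conditional
   distribution of the recipient of the arriving item, given the bids v for
   the j.+1 items that have arrived (the last column is the new one) and the
   past allocation a. *)
Record mechanism (R : realType) (n : nat) := Mechanism {
  rule : forall j : nat,
    'M[R]_(n, j.+1) -> allocation n j -> option 'I_n -> R;
  rule_ge0 : forall j v a x, 0 <= @rule j v a x;
  rule_sum1 : forall j v a, \sum_x @rule j v a x = 1
}.

Definition alloc_prob (R : realType) (n : nat) (M : mechanism R n) (m : nat)
    (v : 'M[R]_(n, m)) (a : allocation n m) : R :=
  \prod_(j < m) rule M (bid_prefix v j) (alloc_prefix a j) (a j).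

Definition receive_prob (R : realType) (n : nat) (M : mechanism R n) (m : nat)
    (v : 'M[R]_(n, m)) (i : 'I_n) (h : 'I_m) : R :=
  \sum_(a : allocation n m | a h == Some i) alloc_prob M v a.

Definition discard_prob (R : realType) (n : nat) (M : mechanism R n) (m : nat)
    (v : 'M[R]_(n, m)) (h : 'I_m) : R :=
  \sum_(a : allocation n m | a h == None) alloc_prob M v a.

(* Bid profiles range over all nonnegative matrices here, so that items
   without a positive bid do occur. *)
Definition nonwasteful (R : realType) (n : nat) (M : mechanism R n) : Prop :=
  forall (m : nat) (v : 'M[R]_(n, m)), (forall i j, 0 <= v i j) ->
  forall j : 'I_m,
    ((exists i, 0 < v i j) ->
       \sum_(i < n | 0 < v i j) receive_prob M v i j = 1) /\
    (~ (exists i, 0 < v i j) -> discard_prob M v j = 1).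

(* Agents are sincere: the mechanism is run on the utility matrix itself. *)
Definition expected_utility (R : realType) (n : nat) (M : mechanism R n)
    (m : nat) (u : 'M[R]_(n, m)) (i k : 'I_n) : R :=
  \sum_(h < m) receive_prob M u k h * u i h.

(* Agent i's own expected utility over the items that k likes; the items that
   i does not like contribute 0. *)
Definition expected_shared_utility (R : realType) (n : nat)
    (M : mechanism R n) (m : nat) (u : 'M[R]_(n, m)) (i k : 'I_n) : R :=
  \sum_(h < m | 0 < u k h) receive_prob M u i h * u i h.

Definition shared_envy_free_ex_ante (R : realType) (n : nat)
    (M : mechanism R n) : Prop :=
  forall (m : nat) (u : 'M[R]_(n, m)), instance u ->
  forall i k : 'I_n,
    expected_shared_utility M u i k >= expected_utility M u i k.

Definition ex_ante_equivalent (R : realType) (n : nat)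
    (M1 M2 : mechanism R n) : Prop :=
  forall (m : nat) (u : 'M[R]_(n, m)), instance u ->
  forall (i : 'I_n) (j : 'I_m), receive_prob M1 u i j = receive_prob M2 u i j.

Definition bidders (R : realType) (n j : nat) (v : 'M[R]_(n, j.+1)) :
    {set 'I_n} :=
  [set i | 0 < v i ord_max].

(* The arriving item is discarded when nobody bids positively for it. *)
Definition like_rule (R : realType) (n j : nat) (v : 'M[R]_(n, j.+1))
    (_ : allocation n j) (x : option 'I_n) : R :=
  match x with
  | Some i => if i \in bidders v then (#|bidders v|%:R)^-1 else 0
  | None => if bidders v == set0 then 1 else 0
  end.

Lemma like_rule_ge0 (R : realType) (n j : nat) (v : 'M[R]_(n, j.+1))
  (a : allocation n j) (x : option 'I_n) : 0 <= like_rule v a x.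
Proof.
by case: x => [i|] /=; case: ifP => // _; rewrite invr_ge0 ler0n.
Qed.

Lemma like_rule_sum1 (R : realType) (n j : nat) (v : 'M[R]_(n, j.+1))
  (a : allocation n j) : \sum_x like_rule v a x = 1.
Proof.
rewrite (bigD1 None) //= (reindex_omap Some id) /=; last by case.
under eq_bigl => i do rewrite eqxx.
rewrite -big_mkcond /= sumr_const.
have [->|nz] := eqVneq (bidders v) set0; first by rewrite cards0 mulr0n addr0.
by rewrite add0r -[_ *+ _]mulr_natr mulVf // pnatr_eq0 cards_eq0.
Qed.

Definition like_mechanism (R : realType) (n : nat) : mechanism R n :=
  Mechanism (@like_rule_ge0 R n) (@like_rule_sum1 R n).

(* Main.v *)
(** Call the like share of agent [i] for an item the probability with which the
    Like mechanism gives it to [i].  If every agent receives every item with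
    its like share, then each term of [expected_shared_utility] equals the
    corresponding term of [expected_utility], which gives one direction.  For
    the other, proceed by induction on the number of items: the probabilities
    for the earlier items are those on the truncated instance, hence like
    shares, so their terms cancel in the envy-freeness inequalities.  What
    remains says that any two agents who like the last item receive it with the
    same probability, and non-wastefulness makes these probabilities sum to
    1. *)
Require Import Defs.
From mathcomp Require Import all_boot all_order all_algebra.
From mathcomp Require Import reals.

Set Implicit Arguments.
Unset Strict Implicit.
Unset Printing Implicit Defensive.

Import Order.TTheory GRing.Theory Num.Theory.
Local Open Scope ring_scope.

Lemma lift_max_widen (m : nat) (j : 'I_m) :
  lift ord_max j = widen_ord (leqnSn m) j.
Proof. by apply: val_inj; apply: lift_max. Qed.

Definition drop_last (R : Type) (n m : nat) (v : 'M[R]_(n, m.+1)) :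
    'M[R]_(n, m) :=
  colsub (widen_ord (leqnSn m)) v.

Definition extend (n m : nat) (b : allocation n m) (x : option 'I_n) :
    allocation n m.+1 :=
  [ffun j => if unlift ord_max j is Some h then b h else x].

Lemma extend_last (n m : nat) (b : allocation n m) (x : option 'I_n) :
  extend b x ord_max = x.
Proof. by rewrite ffunE unlift_none. Qed.

Lemma extend_widen (n m : nat) (b : allocation n m) (x : option 'I_n)
  (h : 'I_m) : extend b x (widen_ord (leqnSn m) h) = b h.
Proof. by rewrite ffunE -lift_max_widen liftK. Qed.

(** An allocation of [m.+1] items is determined by its first [m] recipients and its last one, so
    [extend] is a bijection from such pairs; this drives every induction on the number of items. *)
Lemma sum_extend (R : nmodType) (n m : nat) (P : pred (allocation n m.+1))
  (F : allocation n m.+1 -> R) :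
  \sum_(a | P a) F a = \sum_b \sum_(x | P (extend b x)) F (extend b x).
Proof.
rewrite (pair_big_dep xpredT (fun b x => P (extend b x))) /=.
rewrite (reindex (fun p : allocation n m * option 'I_n => extend p.1 p.2)) //=.
exists (fun a : allocation n m.+1 =>
  ([ffun h => a (widen_ord (leqnSn m) h)] : allocation n m, a ord_max)).
  move=> [b x] _ /=; congr pair; last exact: extend_last.
  by apply/ffunP => h; rewrite ffunE extend_widen.
move=> a _; apply/ffunP => j /=; have [h ->|->] := unliftP ord_max j.
  by rewrite lift_max_widen extend_widen ffunE.
by rewrite extend_last.
Qed.

Section Mechanism.
Variables (R : realType) (n : nat) (M : mechanism R n).

(** The rule is online: in each earlier round it sees the same bids and past in the full run as in
    the truncated one, so only the factor of the last round is new. *)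
Lemma alloc_prob_extend (m : nat) (v : 'M[R]_(n, m.+1)) (b : allocation n m)
  (x : option 'I_n) :
  alloc_prob M v (extend b x) = alloc_prob M (drop_last v) b * rule M v b x.
Proof.
rewrite /alloc_prob big_ord_recr /=; congr (_ * _).
  apply: eq_bigr => h _; rewrite extend_widen.
  have -> : bid_prefix v (widen_ord (leqnSn m) h) = bid_prefix (drop_last v) h.
    by apply/matrixP => i j; rewrite !mxE; congr (v i _); apply: val_inj.
  congr rule; apply/ffunP => j; rewrite [RHS]ffunE [LHS]ffunE.
  rewrite -(extend_widen b x); congr (extend b x _); exact: val_inj.
rewrite extend_last.
have -> : bid_prefix v ord_max = v.
  by apply/matrixP => i j; rewrite !mxE; congr (v i _); apply: val_inj.
congr rule; apply/ffunP => j; rewrite [LHS]ffunE.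
rewrite -(extend_widen b x); congr (extend b x _); exact: val_inj.
Qed.

Lemma alloc_prob_ge0 (m : nat) (v : 'M[R]_(n, m)) (a : allocation n m) :
  0 <= alloc_prob M v a.
Proof. by apply: prodr_ge0 => j _; apply: rule_ge0. Qed.

Lemma alloc_prob_sum1 (m : nat) (v : 'M[R]_(n, m)) :
  \sum_a alloc_prob M v a = 1.
Proof.
elim: m v => [|m IHm] v.
  under eq_bigr => a _ do rewrite /alloc_prob big_ord0.
  by rewrite sumr_const card_ffun card_ord expn0.
rewrite sum_extend -[RHS](IHm (drop_last v)); apply: eq_bigr => b _.
under eq_bigr => x _ do rewrite alloc_prob_extend.
by rewrite -mulr_sumr rule_sum1 mulr1.
Qed.

Lemma receive_prob_ge0 (m : nat) (v : 'M[R]_(n, m)) (i : 'I_n) (h : 'I_m) :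
  0 <= receive_prob M v i h.
Proof. by apply: sumr_ge0 => a _; apply: alloc_prob_ge0. Qed.

(** The recipients of [h] partition the total mass 1; what the agents leave over is the discard
    probability. *)
Lemma receive_prob_sum_le1 (m : nat) (v : 'M[R]_(n, m)) (h : 'I_m) :
  \sum_i receive_prob M v i h <= 1.
Proof.
rewrite -(alloc_prob_sum1 v).
rewrite (partition_big (fun a : allocation n m => a h) xpredT) //=.
rewrite [leRHS](bigD1 None) //= [X in _ + X](reindex_omap Some id) /=; last by case.
under [X in _ + X]eq_bigl => i do rewrite eqxx.
by rewrite lerDr; apply: sumr_ge0 => a _; apply: alloc_prob_ge0.
Qed.

(** Whatever the past, the conditional probabilities of the last round sum to 1, so that round can
    be summed out. *)
Lemma receive_prob_widen (m : nat) (v : 'M[R]_(n, m.+1)) (i : 'I_n)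
  (h : 'I_m) :
  receive_prob M v i (widen_ord (leqnSn m) h) =
  receive_prob M (drop_last v) i h.
Proof.
rewrite /receive_prob sum_extend [RHS]big_mkcond; apply: eq_bigr => b _.
under eq_bigl => x do rewrite extend_widen.
case: ifP => _; last by rewrite big_pred0.
under eq_bigr => x _ do rewrite alloc_prob_extend.
by rewrite -mulr_sumr rule_sum1 mulr1.
Qed.

Lemma receive_prob_last (m : nat) (v : 'M[R]_(n, m.+1)) (i : 'I_n) :
  receive_prob M v i ord_max =
  \sum_b alloc_prob M (drop_last v) b * rule M v b (Some i).
Proof.
rewrite /receive_prob sum_extend; apply: eq_bigr => b _.
under eq_bigl => x do rewrite extend_last.
by rewrite big_pred1_eq alloc_prob_extend.
Qed.

(** The agents who like [h] already exhaust the mass available for it. *)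
Lemma nonwasteful_receive_prob0 (m : nat) (v : 'M[R]_(n, m)) (i : 'I_n)
  (h : 'I_m) :
  \sum_(k < n | 0 < v k h) receive_prob M v k h = 1 ->
  ~~ (0 < v i h) -> receive_prob M v i h = 0.
Proof.
move=> sum1 vi; apply/eqP; rewrite eq_le receive_prob_ge0 andbT.
have := receive_prob_sum_le1 v h.
rewrite (bigID (fun k => 0 < v k h)) /= sum1 gerDl; apply: le_trans.
rewrite (bigD1 i) //= lerDl.
by apply: sumr_ge0 => k _; apply: receive_prob_ge0.
Qed.

End Mechanism.

Definition like_share (R : realType) (n m : nat) (u : 'M[R]_(n, m)) (i : 'I_n)
    (h : 'I_m) : R :=
  if 0 < u i h then #|[set k | 0 < u k h]|%:R^-1 else 0.

Lemma like_share_drop_last (R : realType) (n m : nat) (u : 'M[R]_(n, m.+1))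
  (i : 'I_n) (h : 'I_m) :
  like_share u i (widen_ord (leqnSn m) h) = like_share (drop_last u) i h.
Proof.
rewrite /like_share mxE; case: ifP => // _.
by congr (_%:R^-1); apply: eq_card => k; rewrite !inE mxE.
Qed.

Lemma receive_prob_like (R : realType) (n m : nat) (u : 'M[R]_(n, m))
  (i : 'I_n) (h : 'I_m) :
  receive_prob (like_mechanism R n) u i h = like_share u i h.
Proof.
elim: m u h => [|m IHm] u h; first by case: h.
have [j ->|->] := unliftP ord_max h.
  by rewrite lift_max_widen receive_prob_widen IHm like_share_drop_last.
(* The Like rule ignores the past allocation, so its value factors out and leaves the total mass
   1. *)
by rewrite receive_prob_last -mulr_suml alloc_prob_sum1 mul1r /= inE.
Qed.

(** All agents who like an item have the same like share of it, so [i] and [k] may be exchanged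
    unless [u i h] is 0, when both sides vanish. *)
Lemma like_share_shared_utility (R : realType) (n m : nat) (u : 'M[R]_(n, m))
  (i k : 'I_n) (h : 'I_m) :
  0 <= u i h ->
  (if 0 < u k h then like_share u i h * u i h else 0) =
  like_share u k h * u i h.
Proof.
rewrite /like_share le_eqVlt => /predU1P[<-|->]; first by rewrite !mulr0 if_same.
by case: ifP; rewrite ?mul0r.
Qed.

Lemma instance_drop_last (R : realType) (n m : nat) (u : 'M[R]_(n, m.+1)) :
  instance u -> instance (drop_last u).
Proof.
move=> [u_ge0 u_pos]; split=> [i j|j]; first by rewrite mxE.
by have [i ui] := u_pos (widen_ord (leqnSn m) j); exists i; rewrite mxE.
Qed.

(** Exchanging [i] and [k] makes [p] constant on the agents who like [h]; the sum then fixes the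
    constant. *)
Lemma like_share_of_equal (R : realType) (n m : nat) (u : 'M[R]_(n, m))
  (h : 'I_m) (p : 'I_n -> R) :
  (forall i k, 0 < u i h -> 0 < u k h -> p k <= p i) ->
  \sum_(k < n | 0 < u k h) p k = 1 ->
  forall i, 0 < u i h -> p i = like_share u i h.
Proof.
move=> le_p sum1 i ui; rewrite /like_share ui.
have eq_p k : 0 < u k h -> p k = p i.
  by move=> uk; apply/eqP; rewrite eq_le !le_p.
move: sum1; rewrite (eq_bigr _ eq_p) sumr_const -cardsE => sum1.
have B_neq0 : #|[set k | 0 < u k h]|%:R != 0 :> R.
  by rewrite pnatr_eq0 cards_eq0; apply/set0Pn; exists i; rewrite inE.
by apply: (mulIf B_neq0); rewrite mulVf // mulr_natr.
Qed.

Lemma shared_envy_free_like_share (R : realType) (n : nat) (M : mechanism R n) :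
  nonwasteful M -> shared_envy_free_ex_ante M ->
  forall (m : nat) (u : 'M[R]_(n, m)), instance u ->
  forall i h, receive_prob M u i h = like_share u i h.
Proof.
move=> nwM sefM; elim=> [|m IHm] u u_inst i h; first by case: h.
have early k j : receive_prob M u k (widen_ord (leqnSn m) j) =
    like_share u k (widen_ord (leqnSn m) j).
  rewrite receive_prob_widen like_share_drop_last IHm //.
  exact: instance_drop_last.
have [j ->|->] := unliftP ord_max h; first by rewrite lift_max_widen.
have [u_ge0 u_pos] := u_inst.
have sum1 := (nwM _ u u_ge0 ord_max).1 (u_pos ord_max).
have [ui|ui] := boolP (0 < u i ord_max); last first.
  by rewrite /like_share (negbTE ui) (nonwasteful_receive_prob0 sum1).
apply: (like_share_of_equal (p := fun k => receive_prob M u k ord_max)) => //.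
move=> {i ui} i k ui uk; have := sefM _ u u_inst i k.
rewrite /expected_shared_utility [leRHS]big_mkcond /expected_utility /=.
(* As [k] likes the last item, its term survives in the shared sum. The earlier terms agree by
   [early] and cancel, and the positive factor [u i ord_max] is divided out. *)
rewrite !big_ord_recr /= uk [X in _ <= X + _](eq_bigr (fun j : 'I_m =>
  receive_prob M u k (widen_ord (leqnSn m) j) *
  u i (widen_ord (leqnSn m) j))).
  by rewrite lerD2l ler_pM2r.
by move=> j _; rewrite !early like_share_shared_utility.
Qed.

Theorem theorem5 (R : realType) (n : nat) (M : mechanism R n)
  (hM : nonwasteful M) :
  shared_envy_free_ex_ante M <-> ex_ante_equivalent M (like_mechanism R n).
Proof.
split=> [sefM m u u_inst i j|eqM m u u_inst i k].
  by rewrite receive_prob_like shared_envy_free_like_share.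
(* Envy-freeness holds here with equality, item by item. *)
rewrite /expected_shared_utility big_mkcond le_eqVlt; apply/orP; left.
apply/eqP/eq_bigr => h _; rewrite !eqM // !receive_prob_like.
by rewrite like_share_shared_utility //; case: u_inst.
Qed.
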